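(* Let $N\ge 1$ be an integer, $T>0$, $\gamma\in(0,1)$, $\alpha\in(0,1)$, $\sigma>0$, $\nu,\mu\in\mathbb{R}$ with $\mu>\nu$, and $\rho_1,\dots,\rho_N\in\mathbb{R}$. Suppose that the system of ordinary differential equations on $[0,T]$ $$ \begin{cases} \dot{\theta}_i(t)+(1-\gamma)\theta_i(t)\Big[\nu+\frac{(\mu-\nu)^2}{2\gamma\sigma^2}-\Big(\sum_{j=1}^N\theta_j(t)\Big)^{\frac{1}{\alpha-1}}\sum_{k=1}^N\theta_k(t)^{\frac{1-\gamma-\alpha}{(1-\alpha)(1-\gamma)}}\Big]\\ \quad-(1-\gamma)\rho_i\alpha^{-1}\theta_i(t)+\alpha^{-1}(1-\gamma)\theta_i(t)^{\frac{1-\gamma-\alpha}{(1-\alpha)(1-\gamma)}}\Big(\sum_{j=1}^N\theta_j(t)\Big)^{\frac{\alpha}{\alpha-1}}=0,\\ \theta_i(T)=1,\qquad i=1,\dots,N, \end{cases} $$ has a positive solution $(\theta_1,\dots,\theta_N)$ (that is, $\theta_i(t)>0$ for all $t\in[0,T]$ and all $i$). Let $\bar\pi=(\bar\pi_1,\dots,\bar\pi_N)\in(L^\infty_+(0,T))^N$ satisfy $$\sum_{i=1}^N\bar\pi_i(t)=\frac{\mu-\nu}{\gamma\sigma^2},\qquad t\in[0,T],$$ and let $\bar c=(\bar c_1,\dots,\bar c_N)$ be given by $$\bar c_i(t)=\Big(\sum_{j=1}^N\theta_j(t)\Big)^{\frac{1}{\alpha-1}}\theta_i(t)^{\frac{1-\gamma-\alpha}{(1-\alpha)(1-\gamma)}},\qquad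 t\in[0,T],\ i=1,\dots,N.$$ Then $(\bar\pi,\bar c)$ is an equilibrium Pareto investment-consumption strategy of the coalition.
   Context: $L^\infty_+(0,T)$ is the set of essentially bounded functions $\varphi:[0,T]\to[0,+\infty)$. $W$ is a one-dimensional standard Brownian motion and $\mathbb{E}_s$ is conditional expectation given the Brownian filtration at time $s$. Wealth. For a strategy $(\pi,c)\in(L^\infty_+(0,T))^N\times(L^\infty_+(0,T))^N$, with $\pi=(\pi_1,\dots,\pi_N)$, $c=(c_1,\dots,c_N)$, and initial data $(t,x)$, $x>0$, the wealth $X$ solves $$dX(s)=\Big[\nu X(s)+(\mu-\nu)\sum_{i=1}^N \pi_i(s)X(s)-\sum_{i=1}^N c_i(s)X(s)\Big]ds+\sigma\sum_{i=1}^N\pi_i(s)X(s)\,dW(s),\quad s\in[t,T],\qquad X(t)=x.$$ Utilities. Agent $i$'s utility is $J_i(t,x;\pi,c)=Y_i(t)$, where $Y_i$ solves $$Y_i(s)=\mathbb{E}_s\Big[\int_s^T g_i\big(c_i(r)X(r),Y_i(r)\big)dr+h_i(X(T))\Big],\quad s\in[t,T],$$ $$g_i(q,y)=\alpha^{-1}\big((1-\gamma)y\big)^{1-\frac{\alpha}{1-\gamma}}\Big[q^\alpha-\rho_i\big((1-\gamma)y\big)^{\frac{\alpha}{1-\gamma}}\Big],\qquad h_i(x)=\frac{x^{1-\gamma}}{1-\gamma}.$$ Convention: $Y_i$ always denotes the Markovian solution $Y_i(s)=\frac{\vartheta_i(s)}{1-\gamma}X(s)^{1-\gamma}$, where $\vartheta_i$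 is the unique positive solution on $[0,T]$ of $$\dot{\vartheta}_i+(1-\gamma)\vartheta_i\Big[(\mu-\nu)\sum_{j}\pi_j-\sum_{j} c_j+\nu-\tfrac{\gamma\sigma^2}{2}\big(\sum_{j}\pi_j\big)^2-\tfrac{\rho_i}{\alpha}\Big]+\alpha^{-1}(1-\gamma)\vartheta_i^{\frac{1-\gamma-\alpha}{1-\gamma}}c_i^\alpha=0,\quad \vartheta_i(T)=1.$$ The coalition's objective is $J^\lambda(t,x;\pi,c)=\frac1N\sum_{i=1}^N J_i(t,x;\pi,c)$. Equilibrium. A pair $(\bar\pi,\bar c)\in(L^\infty_+(0,T))^N\times(L^\infty_+(0,T))^N$ is an equilibrium Pareto investment-consumption strategy (EPICS) of the coalition if, with $\bar X$ the wealth process under $(\bar\pi,\bar c)$ (started at time $0$ from a positive initial wealth), $$\limsup_{\varepsilon\to0^+}\frac{J^\lambda(t,\bar X(t);\bar\pi^\varepsilon,\bar c^\varepsilon)-J^\lambda(t,\bar X(t);\bar\pi,\bar c)}{\varepsilon}\le 0$$ for any $t\in[0,T)$ and any $(\pi,c)\in(L^\infty_+(0,T))^N\times(L^\infty_+(0,T))^N$, where for each $i$: $\bar\pi_i^\varepsilon(s)=\pi_i(s)$, $\bar c_i^\varepsilon(s)=c_i(s)$ for $s\in[t,t+\varepsilon)$, and $\bar\pi_i^\varepsilon(s)=\bar\pi_i(s)$, $\bar c_i^\varepsilon(s)=\bar c_i(s)$ for $s\in[t+\varepsilon,T]$. *)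

(* Defs.v *)
From HB Require Import structures.
From mathcomp Require Import all_boot all_order all_algebra.
From mathcomp Require Import all_classical all_reals all_analysis.

Set Implicit Arguments.
Unset Strict Implicit.
Unset Printing Implicit Defensive.

Import Order.TTheory GRing.Theory Num.Theory.
Import numFieldNormedType.Exports.

Local Open Scope classical_set_scope.
Local Open Scope ring_scope.

(** * Deterministic strategies *)

Definition Linfty_plus (R : realType) (T : R) (f : R -> R) : Prop :=
  [/\ measurable_fun `[0, T] f,
      forall t, t \in `[0, T] -> 0 <= f t &
      exists M : R,
        {ae (@lebesgue_measure R), forall t, t \in `[0, T] -> f t <= M}].

(* Used at every point of [0, T]; at the end points it is the one-sided
   derivative. *)
Definition is_derive_within (R : realType) (D : set R) (f : R -> R)
    (t l : R) : Prop :=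
  (s - t)^-1 * (f s - f t) @[s --> within D t^'] --> l.

(** * Brownian motion and the Ito integral *)

Section BrownianMotion.
Context (R : realType) (d : measure_display) (Omega : measurableType d).
Context (P : probability Omega R).
Implicit Types (W H X : R -> Omega -> R) (F : R -> set (set Omega)).

Definition natural_filtration W (t : R) : set (set Omega) :=
  <<s [set A | exists s B,
         [/\ 0 <= s <= t, measurable B & A = W s @^-1` B]] >>.

(* natural filtration augmented by the P-negligible events *)
Definition brownian_filtration W (t : R) : set (set Omega) :=
  <<s natural_filtration W t `|` [set A | measurable A /\ P A = 0%E] >>.

Definition increment W (s t : R) : Omega -> R := fun w => W t w - W s w.

(* Time runs over [0, +oo[; the values of W at negative times are irrelevant.
   The second argument of normal_prob is the standard deviation. *)
Definition brownian_motion W : Prop :=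
  [/\ forall t, 0 <= t -> measurable_fun setT (W t),
      {ae P, forall w, W 0 w = 0},
      {ae P, forall w, {within `[0, +oo[, continuous (fun t => W t w)}},
      forall s t (B : set R), 0 <= s < t -> measurable B ->
        P (increment W s t @^-1` B) =
        normal_prob 0 (Num.sqrt (t - s)) B &
      forall s t (A : set Omega) (B : set R), 0 <= s < t ->
        natural_filtration W s A -> measurable B ->
        P (A `&` increment W s t @^-1` B) =
        (P A * P (increment W s t @^-1` B))%E].

(* The process sum_k val k * 1_(time k, time (k+1)] on [a, b]. *)
Record simple_process F (a b : R) := SimpleProcess {
  sp_size : nat;
  sp_time : nat -> R;
  sp_val : nat -> Omega -> R;
  sp_time_ge : a <= sp_time 0;
  sp_time_le : sp_time sp_size <= b;
  sp_time_mono :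
    forall k, (k < sp_size)%N -> sp_time k <= sp_time k.+1;
  sp_val_adapted : forall k (B : set R), (k < sp_size)%N -> measurable B ->
    F (sp_time k) (sp_val k @^-1` B);
  sp_val_bounded : forall k, (k < sp_size)%N ->
    exists M : R, forall w, `|sp_val k w| <= M }.

Definition simple_eval F a b (S : simple_process F a b) : R -> Omega -> R :=
  fun r w => \sum_(k < sp_size S)
    sp_val S k w * \1_(`]sp_time S k, sp_time S k.+1]) r.

Definition simple_integral W F a b (S : simple_process F a b) : Omega -> R :=
  fun w => \sum_(k < sp_size S)
    sp_val S k w * (W (sp_time S k.+1) w - W (sp_time S k) w).

(* I is (a version of) the Ito integral of H dW over [a, b]: simple processes
   S_m with int_a^b (S_m - H)^2 dr -> 0 in probability have stochastic
   integrals converging to I in probability. The inner integral is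
   extended-real valued, so that it is not lost when infinite. *)
Definition ito_integral W (a b : R) H (I : Omega -> R) : Prop :=
  measurable_fun setT I /\
  exists S : nat -> simple_process (brownian_filtration W) a b,
    (forall e : R, 0 < e ->
      P [set w | (e%:E < \int[lebesgue_measure]_(r in `[a, b])
                   ((simple_eval (S m) r w - H r w) ^+ 2)%:E)%E]
        @[m --> \oo] --> 0%E) /\
    (forall e : R, 0 < e ->
      P [set w | e < `|simple_integral W (S m) w - I w|]
        @[m --> \oo] --> 0%E).

End BrownianMotion.

(** * The coalition *)

Section Coalition.
Context (R : realType) (N : nat).
Implicit Types (pi c : 'I_N -> R -> R) (rho : 'I_N -> R).

Definition admissible (T : R) pi c : Prop :=
  forall i, Linfty_plus T (pi i) /\ Linfty_plus T (c i).

(* X solves the wealth equation on [t, T] with X(t) = x, in the strong sense: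
   it is adapted to the augmented filtration of W, continuous, and
   satisfies the integrated equation almost surely. *)
Definition wealth_process d (Omega : measurableType d)
    (P : probability Omega R) (W : R -> Omega -> R)
    (T nu mu sigma : R) pi c (t x : R) (X : R -> Omega -> R) : Prop :=
  [/\ forall s (B : set R), s \in `[t, T] -> measurable B ->
        brownian_filtration P W s (X s @^-1` B),
      forall w, {within `[t, T], continuous (fun s => X s w)} &
      forall s, s \in `[t, T] -> exists I : Omega -> R,
        ito_integral P W t s
          (fun r w => sigma * (\sum_i pi i r) * X r w) I /\
        {ae P, forall w, X s w = x
           + \int[lebesgue_measure]_(r in `[t, s])
               (nu * X r w + (mu - nu) * (\sum_i pi i r) * X r w
                - (\sum_i c i r) * X r w)
           + I w}].

(* Minus the time derivative of vartheta_i prescribed by its equation, at time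
   r and vartheta_i(r) = v. *)
Definition vartheta_field (nu mu sigma gamma alpha : R) rho pi c (i : 'I_N)
    (r v : R) : R :=
  (1 - gamma) * v *
    ((mu - nu) * (\sum_j pi j r) - (\sum_j c j r) + nu
     - gamma * sigma ^+ 2 / 2 * (\sum_j pi j r) ^+ 2 - rho i / alpha)
  + alpha^-1 * (1 - gamma)
    * v `^ ((1 - gamma - alpha) / (1 - gamma)) * (c i r) `^ alpha.

(* As the coefficients are merely essentially bounded and measurable, solutions
   are meant in the sense of Caratheodory: absolutely continuous functions that
   satisfy the equation almost everywhere, i.e. solutions of the integrated
   equation. *)
Definition vartheta_solution (T nu mu sigma gamma alpha : R) rho pi c
    (i : 'I_N) (v : R -> R) : Prop :=
  [/\ {within `[0, T], continuous v},
      forall s, s \in `[0, T] -> 0 < v s &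
      forall s, s \in `[0, T] ->
        v s = 1 + \int[lebesgue_measure]_(r in `[s, T])
                    vartheta_field nu mu sigma gamma alpha rho pi c i r (v r)].

(* The positive solution is unique on [0, T], the only set where it is used. *)
Definition vartheta (T nu mu sigma gamma alpha : R) rho pi c (i : 'I_N) :
    R -> R :=
  xget (cst 1) (vartheta_solution T nu mu sigma gamma alpha rho pi c i).

(* J_i(t, x; pi, c) = Y_i(t), where Y_i is the solution
   Y_i(s) = vartheta_i(s) / (1 - gamma) * X(s)^(1 - gamma), X(t) = x, of
     Y_i(s) = E_s[int_s^T g_i(c_i(r) X(r), Y_i(r)) dr + h_i(X(T))].
   By convention this Markovian solution is the one that is meant by Y_i, hence
   the recursive equation imposes no further condition. *)
Definition utility (T nu mu sigma gamma alpha : R) rho (i : 'I_N)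
    (t x : R) pi c : R :=
  vartheta T nu mu sigma gamma alpha rho pi c i t / (1 - gamma)
  * x `^ (1 - gamma).

Definition coalition_objective (T nu mu sigma gamma alpha : R) rho
    (t x : R) pi c : R :=
  N%:R^-1 * \sum_i utility T nu mu sigma gamma alpha rho i t x pi c.

(* The values before time t do not matter for the objective at time t. *)
Definition perturb (t e : R) (p pbar : 'I_N -> R -> R) : 'I_N -> R -> R :=
  fun i s => if (t <= s) && (s < t + e) then p i s else pbar i s.

(* The wealth process is unique, and positive, up to indistinguishability;
   inequalities between random variables hold almost surely. *)
Definition EPICS d (Omega : measurableType d) (P : probability Omega R)
    (W : R -> Omega -> R) (T nu mu sigma gamma alpha : R) rho
    (pibar cbar : 'I_N -> R -> R) : Prop :=
  admissible T pibar cbar /\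
  forall (x0 : R) (X : R -> Omega -> R), 0 < x0 ->
    wealth_process P W T nu mu sigma pibar cbar 0 x0 X ->
  forall (t : R) pi c, 0 <= t < T -> admissible T pi c ->
    let J := coalition_objective T nu mu sigma gamma alpha rho t in
    {ae P, forall w,
      (limf_esup (fun e : R =>
         ((J (X t w) (perturb t e pi pibar) (perturb t e c cbar)
           - J (X t w) pibar cbar) / e)%:E) 0^'+ <= 0)%E}.

End Coalition.

(* Main.v *)
Require Import Defs.
From mathcomp Require Import all_boot all_order all_algebra.
From mathcomp Require Import all_classical all_reals all_analysis.
From mathcomp Require Import measurable_realfun ring lra.
Import Order.TTheory GRing.Theory Num.Theory.
Import numFieldNormedType.Exports.
Local Open Scope classical_set_scope.
Local Open Scope ring_scope.

Set Implicit Arguments.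
Unset Strict Implicit.
Unset Printing Implicit Defensive.

(** * Why the strategy is an equilibrium

    The objective at wealth x is a nonnegative multiple,
    x^(1 - gamma) / (N (1 - gamma)), of the sum over i of vartheta_i(t).  Hence
    the wealth only enters through a factor of constant sign, the inequality
    holds for every sample path, and everything reduces to the deterministic
    equations of the vartheta_i.

    Write kappa = (1 - gamma) / alpha.  The equation of vartheta_i is of
    Bernoulli type: v^(1 / kappa) solves a linear equation.  With A the integral
    of the growth coefficient over [s, T] and V the integral over [s, T] of the
    consumption term discounted by exp(- A), the quantity
    v^(1 / kappa) exp(- A) - V is a first integral.  This gives existence,
    uniqueness and a closed form of the positive solution for all merely
    measurable, essentially bounded coefficients ([varthetaE]).  Under the
    candidate strategy the solution is theta_i ([theta_vartheta]), because the
    system of the theta_i is the equation of vartheta_i with the feedback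
    inserted ([dthetaE]).

    A spike perturbation on [t, t + e[ leaves vartheta_i = theta_i after t + e.
    On the spike the first integral built from the deviating strategy is
    conserved, so the perturbed vartheta_i(t) is an explicit function of
    theta_i(t + e) ([vartheta_perturb]) in which e only occurs through t + e.
    Its expansion at e = 0 ([spiked_value_rate]) shows that the gain of the
    deviation is, up to o(e), the integral over the spike of the difference of
    the right-hand sides frozen at theta_i(t).  Summed over i, that difference
    is pointwise nonpositive: the candidate maximizes the sum of the right-hand
    sides, which is a concave quadratic in the total investment plus one
    strictly concave function of each consumption rate
    ([vartheta_field_optimal]).

    The coefficients are only measurable, so the solutions are differentiable
    merely almost everywhere.  To avoid the almost everywhere calculus, a
    derivative is replaced by the statement that f - int_s^T h has derivative
    zero at a point ([has_rate]).  Such statements obey the chain rule at every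
    point; continuous factors in front of h may be frozen at the base point
    ([has_rate_freeze]); and if they hold everywhere, f is the integral of h up
    to a constant ([has_rate_int]). *)

(** * Essentially bounded coefficients *)

Definition ess_bounded {R : realType} (T : R) (h : R -> R) : Prop :=
  measurable_fun `[0, T] h /\
  exists2 M : R, 0 <= M & {ae (@lebesgue_measure R),
    forall r, r \in `[0, T] -> `|h r| <= M}.

Section EssBounded.
Context {R : realType} {T : R}.
Implicit Types (h k : R -> R) (s r : R).
Local Notation mu := (@lebesgue_measure R).

Lemma aeS (P Q : R -> Prop) : (forall r, P r -> Q r) ->
  {ae mu, forall r, P r} -> {ae mu, forall r, Q r}.
Proof. by move=> PQ; apply: filterS => //; exact: (ae_filter_ringOfSetsType mu). Qed.

Lemma aeS2 (P Q S : R -> Prop) : (forall r, P r -> Q r -> S r) ->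
  {ae mu, forall r, P r} -> {ae mu, forall r, Q r} -> {ae mu, forall r, S r}.
Proof. by move=> PQ; apply: filterS2 => //; exact: (ae_filter_ringOfSetsType mu). Qed.

Lemma subitv0T a b : 0 <= a -> b <= T -> `[a, b] `<=` `[0, T].
Proof.
move=> a0 bT x /=; rewrite !in_itv/= => /andP[ax xb].
by rewrite (le_trans a0)// (le_trans xb).
Qed.

Lemma le_int_abs_itv h M a b : measurable_fun `[0, T] h ->
    0 <= M -> {ae mu, forall r, r \in `[a, b] -> `|h r| <= M} ->
    0 <= a -> a <= b -> b <= T ->
  (\int[mu]_(r in `[a, b]) `|(h r)%:E| <= (M * (b - a))%:E)%E.
Proof.
move=> mh M0 hM a0 ab bT.
have mh' : measurable_fun `[a, b] h.
  by apply: measurable_funS mh => //; exact: subitv0T.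
apply: (@le_trans _ _ (\int[mu]_(r in `[a, b]) M%:E)%E).
  apply: ae_ge0_le_integral => //.
  - by apply/measurable_EFinP; apply: measurableT_comp.
rewrite integral_cst//= lebesgue_measure_itv/= lte_fin.
case: ltP => [_|ba]; first by rewrite -EFinD.
by rewrite mule0 lee_fin mulr_ge0// subr_ge0.
Qed.

Lemma ess_bounded_integrable h a b : ess_bounded T h ->
  0 <= a -> b <= T -> mu.-integrable `[a, b] (EFin \o h).
Proof.
move=> [mh [M M0 hM]] a0 bT; apply/integrableP; split.
  apply/measurable_EFinP; apply: measurable_funS mh => //; exact: subitv0T.
have [ab|ba] := leP a b; last first.
  by rewrite set_itv_ge ?bnd_simp -?ltNge// integral_set0.
apply: le_lt_trans (ltry (M * (b - a))); apply: le_int_abs_itv => //.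
by apply: aeS hM => r hr rab; apply: hr; exact: (subitv0T a0 bT).
Qed.

Lemma ess_bounded_cst (c : R) : ess_bounded T (cst c).
Proof.
split; first exact: measurable_cst.
by exists `|c| => //; apply: aeW.
Qed.

Lemma ess_boundedD h k : ess_bounded T h -> ess_bounded T k ->
  ess_bounded T (fun r => h r + k r).
Proof.
move=> [mh [M M0 hM]] [mk [M' M'0 kM]]; split; first exact: measurable_funD.
exists (M + M'); first exact: addr_ge0.
apply: aeS2 hM kM => r hr kr r0T.
by rewrite (le_trans (ler_normD _ _))// lerD ?hr ?kr.
Qed.

Lemma ess_boundedM h k : ess_bounded T h -> ess_bounded T k ->
  ess_bounded T (fun r => h r * k r).
Proof.
move=> [mh [M M0 hM]] [mk [M' M'0 kM]]; split; first exact: measurable_funM.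
exists (M * M'); first exact: mulr_ge0.
apply: aeS2 hM kM => r hr kr r0T.
by rewrite normrM ler_pM ?hr ?kr.
Qed.

Lemma ess_boundedZ (c : R) h : ess_bounded T h -> ess_bounded T (fun r => c * h r).
Proof. exact: ess_boundedM (ess_bounded_cst c). Qed.

Lemma ess_boundedN h : ess_bounded T h -> ess_bounded T (fun r => - h r).
Proof.
by move=> /(ess_boundedZ (-1)); under eq_fun do rewrite mulN1r.
Qed.

Lemma ess_boundedB h k : ess_bounded T h -> ess_bounded T k ->
  ess_bounded T (fun r => h r - k r).
Proof. by move=> ? ?; apply: ess_boundedD => //; exact: ess_boundedN. Qed.

Lemma ess_bounded_sum (I : finType) (h : I -> R -> R) :
  (forall i, ess_bounded T (h i)) -> ess_bounded T (fun r => \sum_i h i r).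
Proof.
move=> bh; elim: (index_enum I) => [|i l ih].
  under eq_fun do rewrite big_nil; exact: ess_bounded_cst.
by under eq_fun do rewrite big_cons; exact: ess_boundedD.
Qed.

Lemma ess_bounded_powR h p : 0 <= p ->
  (forall r, r \in `[0, T] -> 0 <= h r) ->
  ess_bounded T h -> ess_bounded T (fun r => h r `^ p).
Proof.
move=> p0 h0 [mh [M M0 hM]]; split.
  exact: (measurableT_comp (measurable_powR p) mh).
exists (M `^ p); first exact: powR_ge0.
apply: aeS hM => r hr r0T; rewrite ger0_norm ?powR_ge0//.
apply: ge0_ler_powR; rewrite ?nnegrE ?h0//.
by rewrite (le_trans _ (hr r0T))// ler_norm.
Qed.

Lemma ess_bounded_continuous h : {within `[0, T], continuous h} ->
  ess_bounded T h.
Proof.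
move=> ch; split; first exact: subspace_continuous_measurable_fun.
have /compact_bounded[M [_ hM]] := continuous_compact ch (@segment_compact R 0 T).
exists (`|M| + 1); first by rewrite addr_ge0.
apply: aeW => r r0T; apply: hM; first by rewrite ltr_pwDr// ler_norm.
by exists r.
Qed.

Lemma Linfty_plus_ess_bounded f : Linfty_plus T f -> ess_bounded T f.
Proof.
move=> [mf f0 [M fM]]; split => //; exists `|M| => //.
apply: aeS fM => r fr r0T; rewrite ger0_norm ?f0//.
by rewrite (le_trans (fr r0T))// ler_norm.
Qed.

Lemma ess_bounded_eq h k : {in `[0, T], h =1 k} -> ess_bounded T h ->
  ess_bounded T k.
Proof.
move=> hk [mh [M M0 hM]]; split.
  by apply: eq_measurable_fun mh => r; rewrite inE => /hk.
by exists M => //; apply: aeS hM => r hr r0T; rewrite -hk// hr.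
Qed.

End EssBounded.

(** * Integrals over [s, T] *)

Definition tail_int {R : realType} (T : R) (h : R -> R) (s : R) : R :=
  \int[lebesgue_measure]_(r in `[s, T]) h r.

Section TailIntegral.
Context {R : realType} {T : R}.
Implicit Types (h k : R -> R) (s r : R).
Local Notation mu := (@lebesgue_measure R).

Lemma tail_intT h : tail_int T h T = 0.
Proof. by rewrite /tail_int set_itv1 Rintegral_set1. Qed.

Lemma tail_intD h k s : ess_bounded T h -> ess_bounded T k -> 0 <= s ->
  tail_int T (fun r => h r + k r) s = tail_int T h s + tail_int T k s.
Proof.
by move=> bh bk s0; rewrite /tail_int RintegralD//; exact: (ess_bounded_integrable (T := T)).
Qed.

Lemma tail_intZ c h s : ess_bounded T h -> 0 <= s ->
  tail_int T (fun r => c * h r) s = c * tail_int T h s.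
Proof.
by move=> bh s0; rewrite /tail_int RintegralZl//; exact: (ess_bounded_integrable (T := T)).
Qed.

Lemma eq_tail_int h k s : 0 <= s -> {in `[0, T], h =1 k} ->
  tail_int T h s = tail_int T k s.
Proof.
move=> s0 hk; apply: eq_Rintegral => r; rewrite inE => rsT; apply: hk.
exact: (subitv0T s0 (lexx T)).
Qed.

Lemma tail_int_sub h s r : ess_bounded T h -> 0 <= s -> s <= r -> r <= T ->
  tail_int T h s - tail_int T h r = \int[mu]_(x in `[s, r]) h x.
Proof.
move=> bh s0 sr rT; rewrite /tail_int.
have ih : mu.-integrable `[s, T] (EFin \o h) by exact: (ess_bounded_integrable (T := T)).
rewrite -(Rintegral_itv_obnd_cbnd (r := r)); last first.
  by apply: integrableS ih => //; apply: subset_itvr; rewrite bnd_simp.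
by rewrite -(Rintegral_itvB (x := r) ih)// ?bnd_simp// opprB addrC subrK.
Qed.

Lemma eq_tail_int_sub h k s r : ess_bounded T h -> ess_bounded T k ->
    0 <= s -> s <= r -> r <= T -> {in `[s, r[, h =1 k} ->
  tail_int T h s - tail_int T h r = tail_int T k s - tail_int T k r.
Proof.
move=> bh bk s0 sr rT hk; rewrite !tail_int_sub//.
have int f : ess_bounded T f -> mu.-integrable `[s, r[ (EFin \o f).
  move=> bf; have := ess_bounded_integrable bf s0 rT.
  by apply: integrableS => //; apply: subset_itvl; rewrite bnd_simp.
rewrite -!Rintegral_itv_bndo_bndc; [|exact: int..].
by apply: eq_Rintegral => x; rewrite inE => /hk.
Qed.

Lemma tail_int_sub_le h M s r : ess_bounded T h ->
    0 <= M -> 0 <= s -> s <= r -> r <= T ->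
    {ae mu, forall x, x \in `[s, r] -> `|h x| <= M} ->
  `|tail_int T h s - tail_int T h r| <= M * (r - s).
Proof.
move=> bh M0 s0 sr rT hM; rewrite tail_int_sub//.
have ih : mu.-integrable `[s, r] (EFin \o h) by exact: (ess_bounded_integrable (T := T)).
by rewrite -lee_fin EFin_normr_Rintegral// (le_trans (le_abse_integral _ _ _))//;
  [case/integrableP : ih|exact: (le_int_abs_itv (T := T) bh.1)].
Qed.

Lemma tail_int_dist_le h M s r : ess_bounded T h -> 0 <= M ->
    s \in `[0, T] -> r \in `[0, T] ->
    {ae mu, forall x, x \in `[0, T] -> `|x - s| <= `|r - s| -> `|h x| <= M} ->
  `|tail_int T h r - tail_int T h s| <= M * `|r - s|.
Proof.
rewrite !in_itv/= => bh M0 /andP[s0 sT] /andP[r0 rT] hM.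
have [sr|/ltW rs] := leP s r.
  rewrite distrC (ger0_norm (x := r - s)) ?subr_ge0//; apply: tail_int_sub_le => //.
  apply: aeS hM => x hx; rewrite in_itv/= => /andP[sx xr]; apply: hx.
    by rewrite in_itv/= (le_trans s0)// (le_trans xr).
  by rewrite !ger0_norm ?subr_ge0// lerB.
rewrite (distrC r s) (ger0_norm (x := s - r)) ?subr_ge0//; apply: tail_int_sub_le => //.
apply: aeS hM => x hx; rewrite in_itv/= => /andP[rx xs]; apply: hx.
  by rewrite in_itv/= (le_trans r0)// (le_trans xs).
by rewrite !ler0_norm ?subr_le0// !opprB lerB.
Qed.

Lemma tail_int_lipschitz h : ess_bounded T h -> exists2 M, 0 <= M &
  forall s r, s \in `[0, T] -> r \in `[0, T] ->
  `|tail_int T h r - tail_int T h s| <= M * `|r - s|.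
Proof.
move=> bh; have [_ [M M0 hM]] := bh; exists M => // s r sT rT.
by apply: tail_int_dist_le => //; apply: aeS hM => x hx xT _; exact: hx.
Qed.

End TailIntegral.

(** * First-order calculus of absolutely continuous functions *)

Definition flat_at {R : realType} (T s : R) (D : R -> R) : Prop :=
  forall eta : R, 0 < eta -> \forall r \near s, r \in `[0, T] ->
    `|D r - D s| <= eta * `|r - s|.

(** Equivalently f s - f r is the integral of h over [s, r] up to o(r - s): since
    terminal values are prescribed, h is the rate of f in reversed time.  The
    density h is only defined up to null sets, which is why its value at s does
    not occur. *)
Definition has_rate {R : realType} (T s : R) (f h : R -> R) : Prop :=
  flat_at T s (fun r => f r - tail_int T h r).

Section RateCalculus.
Context {R : realType} {T : R}.
Implicit Types (f g h k D : R -> R) (s r : R).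

Lemma flat_atD s D E : flat_at T s D -> flat_at T s E ->
  flat_at T s (fun r => D r + E r).
Proof.
move=> fD fE eta eta0; have e2 : 0 < eta / 2 by rewrite divr_gt0.
move: (fD _ e2) (fE _ e2); apply: filterS2 => r Dr Er rT.
rewrite opprD addrACA (le_trans (ler_normD _ _))//.
by rewrite [leRHS](_ : _ = eta / 2 * `|r - s| + eta / 2 * `|r - s|);
  [rewrite lerD ?Dr ?Er|lra].
Qed.

Lemma flat_atZ c s D : flat_at T s D -> flat_at T s (fun r => c * D r).
Proof.
move=> fD eta eta0; have e2 : 0 < eta / (`|c| + 1).
  by rewrite divr_gt0// ltr_wpDl.
move: (fD _ e2); apply: filterS => r Dr rT.
rewrite -mulrBr normrM (le_trans (ler_wpM2l _ (Dr rT)))// mulrA ler_wpM2r//.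
by rewrite mulrA ler_pdivrMr ?ltr_wpDl// mulrDr mulr1 mulrC lerDl ltW.
Qed.

Lemma eq_flat_at s D E : s \in `[0, T] -> {in `[0, T], D =1 E} ->
  flat_at T s D -> flat_at T s E.
Proof.
move=> sT DE fD eta eta0; move: (fD _ eta0); apply: filterS => r Dr rT.
by rewrite -!DE// Dr.
Qed.

Lemma flat_at_continuous D : (forall s, s \in `[0, T] -> flat_at T s D) ->
  {within `[0, T], continuous D}.
Proof.
move=> fD; apply/subspace_continuousP => s sT; apply/cvgrPdist_le => /= e e0.
rewrite near_withinE; have re : \forall r \near s, `|r - s| <= e.
  by exists e => // r /= /ltW; rewrite distrC.
move: (fD s sT 1 ltr01) re; apply: filterS2 => r Dr re rT.
by rewrite distrC (le_trans (Dr rT))// mul1r.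
Qed.

(** The derivative within [0, T] vanishes everywhere, so the mean value theorem
    applies. *)
Lemma flat_at_cst D s : (forall s, s \in `[0, T] -> flat_at T s D) ->
  s \in `[0, T] -> D s = D T.
Proof.
move=> fD sT; have [s0 sleT] : 0 <= s /\ s <= T.
  by move: sT; rewrite in_itv/= => /andP[].
apply/esym/eqP; rewrite -subr_eq0; apply/eqP.
have [|||c _ ->] := @MVT_segment R D (fun=> 0) s T => //; last by rewrite mul0r.
- move=> x; rewrite in_itv/= => /andP[sx xT].
  have xT' : x \in `[0, T] by rewrite in_itv/= (le_trans s0 (ltW sx)) ltW.
  suff cD : h^-1 *: (D (h *: 1 + x) - D x) @[h --> 0^'] --> (0 : R).
    split; first by apply/cvg_ex; exists 0.
    exact/cvg_lim.
  apply/cvgr0Pnorm_le => /= e e0; have := fD x xT' e e0.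
  move=> [d /= d0 hd]; have x0 := le_lt_trans s0 sx.
  have xT0 : 0 < T - x by rewrite subr_gt0.
  exists (Num.min d (Num.min x (T - x))); first by rewrite /= !lt_min d0 x0.
  move=> h; rewrite /ball_/= sub0r normrN !lt_min => /and3P[hd' hx hT] h0.
  have := hd (h + x); rewrite /ball_/= opprD addrCA subrr addr0 normrN.
  move=> /(_ hd'); rewrite addrK [_ *: 1]mulr1 => /(_ _)/wrap[].
    move: hx hT; rewrite !ltr_norml in_itv/= => /andP[hx _] /andP[_ hT].
    by rewrite -lerBlDr sub0r ltW//= -lerBrDr ltW.
  move=> Dh; rewrite normrM normfV ler_pdivrMl ?normr_gt0// mulrC.
  exact: Dh.
- apply: continuous_subspaceW (flat_at_continuous fD).
  exact: subitv0T.
Qed.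

Lemma flat_at_add s f g : flat_at T s (fun r => f r - g r) ->
  flat_at T s g -> flat_at T s f.
Proof. by move=> fg /(flat_atD fg); under eq_fun do rewrite subrK. Qed.

Lemma has_rate_tail_int s h : has_rate T s (tail_int T h) h.
Proof.
by move=> e e0; apply: filterE => r _; rewrite !subrr normr0 mulr_ge0// ltW.
Qed.

Lemma eq_has_rate s f g h k : s \in `[0, T] -> {in `[0, T], f =1 g} ->
  {in `[0, T], h =1 k} -> has_rate T s f h -> has_rate T s g k.
Proof.
move=> sT fg hk; apply: eq_flat_at => // r rT; rewrite fg//.
by rewrite (@eq_tail_int _ _ h k)//; move: rT; rewrite in_itv/= => /andP[].
Qed.

Lemma has_rateD s f g h k : s \in `[0, T] ->
    ess_bounded T h -> ess_bounded T k ->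
  has_rate T s f h -> has_rate T s g k ->
  has_rate T s (fun r => f r + g r) (fun r => h r + k r).
Proof.
move=> sT bh bk fh gk; apply: eq_flat_at (flat_atD fh gk) => // r.
by rewrite in_itv/= => /andP[r0 _]; rewrite tail_intD// opprD addrACA.
Qed.

Lemma has_rateZ c s f h : s \in `[0, T] -> ess_bounded T h ->
  has_rate T s f h -> has_rate T s (fun r => c * f r) (fun r => c * h r).
Proof.
move=> sT bh fh; apply: eq_flat_at (flat_atZ c fh) => // r.
by rewrite in_itv/= => /andP[r0 _]; rewrite tail_intZ// mulrBr.
Qed.

Lemma has_rate_cst c s : has_rate T s (cst c) (cst 0).
Proof.
move=> e e0; apply: filterE => r _.
by rewrite /tail_int !Rintegral_cst// !mul0r !subr0 subrr normr0 mulr_ge0// ltW.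
Qed.

Lemma has_rate_lipschitz s f h : s \in `[0, T] -> ess_bounded T h ->
  has_rate T s f h -> exists2 C, 0 < C &
    \forall r \near s, r \in `[0, T] -> `|f r - f s| <= C * `|r - s|.
Proof.
move=> sT bh fh; have [M M0 hM] := tail_int_lipschitz bh.
exists (1 + M); first by rewrite ltr_pwDl.
move: (fh 1 ltr01); apply: filterS => r fr rT.
have -> : f r - f s = ((f r - tail_int T h r) - (f s - tail_int T h s)) +
  (tail_int T h r - tail_int T h s) by ring.
by rewrite (le_trans (ler_normD _ _))// mulrDl lerD ?fr ?hM.
Qed.

Lemma has_rate_continuous f :
  (forall s, s \in `[0, T] -> exists2 h, ess_bounded T h & has_rate T s f h) ->
  {within `[0, T], continuous f}.
Proof.
move=> fh; apply/subspace_continuousP => s sT; apply/cvgrPdist_le => /= e e0.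
have [h bh {}fh] := fh s sT; have [C C0 fC] := has_rate_lipschitz sT bh fh.
rewrite near_withinE; have re : \forall r \near s, `|r - s| <= e / C.
  by exists (e / C) => [|r /= /ltW]; [rewrite /= divr_gt0|rewrite distrC].
move: fC re; apply: filterS2 => r Dr re rT.
by rewrite distrC (le_trans (Dr rT))// mulrC -ler_pdivlMr.
Qed.

(** The two densities differ by (k r - k s) h r.  Near s this is at most any given
    multiple of the essential bound of h, so its integral is o(r - s). *)
Lemma has_rate_freeze s f k h g : s \in `[0, T] ->
    {within `[0, T], continuous k} -> ess_bounded T h -> ess_bounded T g ->
  has_rate T s f (fun r => k r * h r + g r) <->
  has_rate T s f (fun r => k s * h r + g r).
Proof.
move=> sT ck bh bg; have [mh [M M0 hM]] := bh.
have bk := ess_bounded_continuous ck.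
have bd : ess_bounded T (fun r => (k r - k s) * h r).
  by apply: ess_boundedM => //; apply: ess_boundedD => //; exact: ess_bounded_cst.
have fd : flat_at T s (tail_int T (fun r => (k r - k s) * h r)).
  move=> e e0; have e1 : 0 < e / (M + 1) by rewrite divr_gt0// ltr_wpDl.
  have /subspace_continuousP/(_ s sT)/cvgrPdist_le/(_ _ e1) := ck.
  rewrite near_withinE => -[d /= d0 kd]; exists d => //= r rd rT.
  apply: tail_int_dist_le => //; first exact: ltW.
  apply: aeS hM => x hx xT xr.
  rewrite normrM (le_trans (ler_pM _ _ (_ : _ <= e / (M + 1)) (hx xT)))//.
    rewrite distrC; apply: kd => //=.
    by rewrite /ball_/= distrC (le_lt_trans xr)// distrC.
  by rewrite -mulrA ger_pMr// mulrC ler_pdivrMr ?ltr_wpDl// mul1r lerDl.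
have bM : ess_bounded T (fun r => k r * h r) by exact: ess_boundedM.
have bS : ess_bounded T (fun r => k s * h r) by exact: ess_boundedZ.
have tE r : r \in `[0, T] -> tail_int T (fun r => k r * h r + g r) r =
    tail_int T (fun r => (k r - k s) * h r) r +
    tail_int T (fun r => k s * h r + g r) r.
  rewrite in_itv/= => /andP[r0 _]; rewrite -tail_intD//; last exact: ess_boundedD.
  by congr (tail_int _ _ _); apply/funext => x; ring.
split => fh.
  apply: eq_flat_at (flat_atD fh fd) => // r rT.
  by rewrite tE//; ring.
apply: eq_flat_at (flat_atD fh (flat_atZ (-1) fd)) => // r rT.
by rewrite tE//; ring.
Qed.

(** Chain rule.  The error of the linear approximation of phi at f s is
    o(f r - f s), and this is o(r - s) because f is Lipschitz at s. *)
Lemma has_rate_comp s f h phi d : s \in `[0, T] -> ess_bounded T h ->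
    has_rate T s f h -> is_derive (f s) 1 phi d ->
  has_rate T s (fun r => phi (f r)) (fun r => d * h r).
Proof.
move=> sT bh fh [dphi dE].
have [C C0 fC] := has_rate_lipschitz sT bh fh.
have taylor e : 0 < e -> \forall r \near s, r \in `[0, T] ->
    `|phi (f r) - phi (f s) - d * (f r - f s)| <= e * `|r - s|.
  move=> e0; have e1 : 0 < e / C by rewrite divr_gt0.
  have /cvgrPdist_le/(_ _ e1) := dphi; rewrite -[lim _]/('D_1 phi (f s)) dE.
  move=> [del /= del0 hdel].
  have rd : \forall r \near s, `|r - s| < del / C.
    by exists (del / C) => [|r /=]; [rewrite /= divr_gt0|rewrite distrC].
  move: fC rd; apply: filterS2 => r fr rd rT; have {}fr := fr rT.
  have [->|fne] := eqVneq (f r) (f s).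
    by rewrite !subrr mulr0 subrr normr0 mulr_ge0// ltW.
  have := hdel (f r - f s).
  rewrite /ball_/= sub0r normrN subr_eq0 => /(_ _ fne)/wrap[].
    by rewrite (le_lt_trans fr)// mulrC -ltr_pdivlMr.
  rewrite [_ *: 1]mulr1 subrK => /(ler_wpM2r (normr_ge0 (f r - f s))).
  rewrite -normrM mulrBl mulrAC mulVf ?subr_eq0// mul1r distrC => H.
  by rewrite (le_trans H)// mulrAC ler_pdivrMr// -mulrA ler_pM2l// mulrC.
apply: (@flat_at_add _ _ (fun r => d * (f r - tail_int T h r)));
  last exact: flat_atZ.
move=> e e0; move: (taylor e e0); apply: filterS => r hr rT.
rewrite (le_trans _ (hr rT))// le_eqVlt; apply/orP; left; apply/eqP; congr `|_|.
have [r0 s0] : 0 <= r /\ 0 <= s.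
  by move: rT sT; rewrite !in_itv/= => /andP[-> _] /andP[-> _].
by rewrite !tail_intZ//; ring.
Qed.

Lemma has_rate_sum (I : finType) s (f h : I -> R -> R) : s \in `[0, T] ->
    (forall i, ess_bounded T (h i)) -> (forall i, has_rate T s (f i) (h i)) ->
  has_rate T s (fun r => \sum_i f i r) (fun r => \sum_i h i r).
Proof.
move=> sT bh fh.
suff [] : ess_bounded T (fun r => \sum_i h i r) /\
  has_rate T s (fun r => \sum_i f i r) (fun r => \sum_i h i r) by [].
elim: (index_enum I) => [|i l [ihb ih]].
  split.
    by apply: ess_bounded_eq (ess_bounded_cst 0) => r _; rewrite big_nil.
  by apply: eq_has_rate (has_rate_cst 0 s) => // r _; rewrite big_nil.
split.
  by apply: ess_bounded_eq (ess_boundedD (bh i) ihb) => r _; rewrite big_cons.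
by apply: eq_has_rate (has_rateD sT (bh i) ihb (fh i) ih) => // r _; rewrite big_cons.
Qed.

Lemma tail_int_cst c r : r <= T -> tail_int T (cst c) r = c * (T - r).
Proof.
move=> rT; rewrite /tail_int Rintegral_cst//= lebesgue_measure_itv/= lte_fin.
by case: ltP => //= Tr; congr (_ * _); lra.
Qed.

(** A classical derivative is a constant density; the sign changes because rates
    are taken in reversed time. *)
Lemma has_rate_derive s f l : s \in `[0, T] ->
  is_derive_within `[0, T] f s l -> has_rate T s f (cst (- l)).
Proof.
move=> sT fl e e0; have /cvgrPdist_le/(_ _ e0) := fl.
rewrite near_withinE/= => -[d /= d0 hd]; exists d => //= r rd rT.
have [rs|rs] := eqVneq r s; first by rewrite rs !subrr normr0 mulr0.
have rs0 : 0 < `|r - s| by rewrite normr_gt0 subr_eq0.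
have := hd r rd rs rT; rewrite -(ler_pM2r rs0) -normrM mulrBl mulrAC mulVf; last first.
  by rewrite subr_eq0.
rewrite mul1r; apply: le_trans; rewrite !tail_int_cst.
- by rewrite distrC le_eqVlt; apply/orP; left; apply/eqP; congr `|_|; ring.
- by move: sT; rewrite in_itv/= => /andP[].
- by move: rT; rewrite in_itv/= => /andP[].
Qed.

(** The fundamental theorem of calculus: f minus the integral of h is flat at every
    point, hence constant. *)
Lemma has_rate_int f h s : (forall r, r \in `[0, T] -> has_rate T r f h) ->
  s \in `[0, T] -> f s = f T + tail_int T h s.
Proof.
move=> fh sT; have := flat_at_cst fh sT.
by rewrite tail_intT subr0 => <-; rewrite subrK.
Qed.

(** The integral of h over [t, t + e] is nonnegative, so f cannot increase by more
    than the first-order error. *)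
Lemma has_rate_ge0 t f h eta : 0 <= t < T -> ess_bounded T h ->
    (forall r, r \in `[0, T] -> 0 <= h r) -> has_rate T t f h -> 0 < eta ->
  \forall e \near 0^'+, f (t + e) - f t <= eta * e.
Proof.
move=> /andP[t0 tT] bh h0 fh eta0.
have [d /= d0 hd] := fh eta eta0.
near=> e.
have e0 : 0 < e by near: e; exact: nbhs_right_gt.
have ed : e < d by near: e; exact: nbhs_right_lt.
have eT : e < T - t by near: e; apply: nbhs_right_lt; rewrite subr_gt0.
have teT : t + e <= T by rewrite addrC -lerBrDr ltW.
have := hd (t + e); rewrite /ball_/= opprD addrA subrr sub0r normrN gtr0_norm//.
rewrite in_itv/= teT addr_ge0 ?(ltW e0)// => /(_ ed isT).
rewrite (_ : t + e - t = e) ?[`|e|]gtr0_norm//; last by ring.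
have : 0 <= tail_int T h t - tail_int T h (t + e).
  rewrite tail_int_sub// ?lerDl ?(ltW e0)//; apply: Rintegral_ge0 => x/= xt.
  by apply: h0; apply: subitv0T xt.
move=> I0 H; have := le_trans (ler_norm _) H; lra.
Unshelve. all: by end_near. Qed.

End RateCalculus.

(** * Continuity on the time interval *)

Section ContinuityItv.
Context {R : realType} {T : R}.

Lemma itv_continuous_comp (f phi : R -> R) : {within `[0, T], continuous f} ->
    (forall s, s \in `[0, T] -> {for f s, continuous phi}) ->
  {within `[0, T], continuous (fun s => phi (f s))}.
Proof.
move=> /subspace_continuousP cf cphi; apply/subspace_continuousP => s sT.
by apply: (cvg_comp _ _ (cf s sT)); exact: cphi.
Qed.

Lemma within_continuous_sum (I : finType) (D : set R) (f : I -> R -> R) :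
  (forall i, {within D, continuous (f i)}) ->
  {within D, continuous (fun r => \sum_i f i r)}.
Proof.
move=> cf x; apply: cvg_big => [|i _]; first exact: add_continuous.
exact: cf.
Qed.

Lemma eq_itv_continuous (f g : R -> R) :
  (forall r, r \in `[0, T] -> f r = g r) ->
  {within `[0, T], continuous f} -> {within `[0, T], continuous g}.
Proof. by move=> fg; apply: subspace_eq_continuous => r; rewrite inE => /fg. Qed.

Lemma within_continuousM (D : set R) (f g : R -> R) :
  {within D, continuous f} -> {within D, continuous g} ->
  {within D, continuous (fun r => f r * g r)}.
Proof. by move=> cf cg x; apply: cvgM; [exact: cf|exact: cg]. Qed.

Lemma within_continuous_powR (f : R -> R) p :
  {within `[0, T], continuous f} -> (forall r, r \in `[0, T] -> 0 < f r) ->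
  {within `[0, T], continuous (fun r => f r `^ p)}.
Proof.
move=> cf f0; apply: (itv_continuous_comp (phi := fun x => x `^ p)) cf _ => r rT.
apply/differentiable_continuous/derivable1_diffP.
by apply: derivable_powR; rewrite in_itv/= f0.
Qed.

End ContinuityItv.

(** * The Bernoulli equation *)

(** With u = v^(1 / kappa), the equation - v' = kappa (a v + b v^(1 - 1 / kappa))
    becomes the linear equation - u' = a u + b. *)
Definition bernoulli {R : realType} (kappa : R) (a b : R -> R) (r v : R) : R :=
  kappa * (v * a r + v `^ (1 - kappa^-1) * b r).

Definition discounted {R : realType} (T : R) (a b : R -> R) : R -> R :=
  tail_int T (fun r => expR (- tail_int T a r) * b r).

(** The power kappa of exp(A) (1 + V), where A = tail_int T a and
    V = discounted T a b: the variation of constants formula for u with u(T) = 1.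
    Written with exp and ln it is a composition of sums with functions of one
    variable, so one chain rule suffices. *)
Definition bernoulli_sol {R : realType} (T kappa : R) (a b : R -> R) (s : R) : R :=
  expR (kappa * (tail_int T a s + ln (1 + discounted T a b s))).

(** v^(1 / kappa) exp(- A(s)) - V(s), which is constant along the solutions: it is
    the constant of integration of the linear equation for u. *)
Definition first_integral {R : realType} (T kappa : R) (a b : R -> R)
    (s v : R) : R :=
  expR (kappa^-1 * ln v - tail_int T a s) - discounted T a b s.

Section Bernoulli.
Context {R : realType} {T kappa : R}.
Hypothesis kappa_gt0 : 0 < kappa.
Implicit Types (a b f h : R -> R) (s r : R).

Let itv_ge0 s : s \in `[0, T] -> 0 <= s.
Proof. by rewrite in_itv/= => /andP[]. Qed.

Lemma expRN_tail_int_continuous h : ess_bounded T h ->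
  {within `[0, T], continuous (fun r => expR (- tail_int T h r))}.
Proof.
move=> bh; rewrite (_ : (fun r => _) = (fun r => expR (-1 * tail_int T h r))); last first.
  by apply/funext => r; rewrite mulN1r.
apply: has_rate_continuous => s sT; eexists; last first.
  apply: (has_rate_comp sT (ess_boundedZ (-1) bh) _ (is_derive_expR _)).
  exact/has_rateZ/has_rate_tail_int.
exact/ess_boundedZ/ess_boundedZ.
Qed.

Lemma ess_bounded_discounted a b : ess_bounded T a -> ess_bounded T b ->
  ess_bounded T (fun r => expR (- tail_int T a r) * b r).
Proof.
move=> ba bb; apply: ess_boundedM => //.
exact/ess_bounded_continuous/expRN_tail_int_continuous.
Qed.

Lemma has_rate_discounted a b s : s \in `[0, T] ->
    ess_bounded T a -> ess_bounded T b ->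
  has_rate T s (discounted T a b) (fun r => expR (- tail_int T a s) * b r).
Proof.
move=> sT ba bb.
have bz := ess_bounded_cst (T := T) 0.
have /iffLR H := has_rate_freeze (discounted T a b) sT
  (expRN_tail_int_continuous ba) bb bz.
apply: eq_has_rate (H _) => // [r _|]; first by rewrite addr0.
apply: eq_has_rate (has_rate_tail_int s _) => // r _.
by rewrite addr0.
Qed.

Lemma discounted_ge0 a b s : 0 <= s ->
  (forall r, r \in `[0, T] -> 0 <= b r) -> 0 <= discounted T a b s.
Proof.
move=> s0 b0; apply: Rintegral_ge0 => r rT; rewrite mulr_ge0 ?expR_ge0//.
by apply: b0; exact: (subitv0T s0 (lexx T)).
Qed.

(** Here f need not solve the equation with coefficients a and b: the rate measures
    by how much it fails to, and it vanishes when h is the right-hand side. *)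
Lemma has_rate_first_integral a b f h s : s \in `[0, T] ->
    ess_bounded T a -> ess_bounded T b -> ess_bounded T h ->
    0 < f s -> has_rate T s f h ->
  has_rate T s (fun r => first_integral T kappa a b r (f r))
    (fun r => expR (kappa^-1 * ln (f s) - tail_int T a s) *
                (kappa^-1 * (f s)^-1 * h r - a r)
              - expR (- tail_int T a s) * b r).
Proof.
move=> sT ba bb bh fs0 fh.
have H1 := has_rate_comp sT bh fh (is_derive1_ln fs0).
have H2 := has_rateZ kappa^-1 sT (ess_boundedZ _ bh) H1.
have H3 := has_rateD sT (ess_boundedZ _ (ess_boundedZ _ bh)) (ess_boundedZ _ ba)
  H2 (has_rateZ (-1) sT ba (has_rate_tail_int s a)).
have H4 := has_rate_comp sT
   (ess_boundedD (ess_boundedZ _ (ess_boundedZ _ bh)) (ess_boundedZ _ ba))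
   H3 (is_derive_expR _).
have H5 := has_rateD sT
  (ess_boundedZ _ (ess_boundedD (ess_boundedZ _ (ess_boundedZ _ bh)) (ess_boundedZ _ ba)))
  (ess_boundedZ _ (ess_boundedZ _ bb))
  H4 (has_rateZ (-1) sT (ess_boundedZ _ bb) (has_rate_discounted sT ba bb)).
apply: eq_has_rate H5 => //= r rT; rewrite /first_integral !mulN1r//.
by rewrite mulrA.
Qed.

(** The Caratheodory form of the equation has v(r) under the integral; chain rule
    computations at s produce v(s) instead. *)
Lemma bernoulli_rate_frozen a b f s : s \in `[0, T] ->
    ess_bounded T a -> ess_bounded T b ->
    {within `[0, T], continuous f} -> (forall r, r \in `[0, T] -> 0 < f r) ->
  has_rate T s f (fun r => bernoulli kappa a b r (f r)) <->
  has_rate T s f (fun r => bernoulli kappa a b r (f s)).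
Proof.
move=> sT ba bb cf f0.
have ckM g : {within `[0, T], continuous g} ->
    {within `[0, T], continuous (fun r => kappa * g r)}.
  by move=> cg; apply: (itv_continuous_comp (phi := *%R kappa)) cg _ => r _;
    exact: mulrl_continuous.
have cfp := ckM _ (within_continuous_powR (p := 1 - kappa^-1) cf f0).
have ckf := ckM _ cf.
have bkf := ess_bounded_continuous ckf.
have H1 := @has_rate_freeze _ _ s f _ a
  (fun r => kappa * f r `^ (1 - kappa^-1) * b r) sT ckf ba
  (ess_boundedM (ess_bounded_continuous cfp) bb).
have H2 := @has_rate_freeze _ _ s f _ b
  (fun r => kappa * f s * a r) sT cfp bb (ess_boundedZ _ ba).
have E1 : (fun r => bernoulli kappa a b r (f r)) =
  (fun r => kappa * f r * a r + kappa * f r `^ (1 - kappa^-1) * b r).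
  by apply/funext => r; rewrite /bernoulli mulrDr !mulrA.
have E2 : (fun r => bernoulli kappa a b r (f s)) =
  (fun r => kappa * f s `^ (1 - kappa^-1) * b r + kappa * f s * a r).
  by apply/funext => r; rewrite /bernoulli mulrDr !mulrA addrC.
rewrite E1 E2; apply: (iff_trans H1); apply: iff_trans H2.
by under eq_fun do rewrite addrC.
Qed.

Lemma bernoulli_sol_gt0 a b s : 0 < bernoulli_sol T kappa a b s.
Proof. exact: expR_gt0. Qed.

Lemma bernoulli_solT a b : bernoulli_sol T kappa a b T = 1.
Proof. by rewrite /bernoulli_sol /discounted !tail_intT addr0 ln1 addr0 mulr0 expR0. Qed.

(** Recovers the value of a solution at s from the value of the first integral. *)
Lemma first_integralK a b s v : 0 < v ->
  expR (kappa * (tail_int T a s +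
    ln (discounted T a b s + first_integral T kappa a b s v))) = v.
Proof.
move=> v0; rewrite /first_integral [discounted _ _ _ _ + _]addrC subrK expRK addrC subrK.
by rewrite mulVKf ?gt_eqF// lnK.
Qed.

Lemma first_integral_sol a b s :
    (forall r, r \in `[0, T] -> 0 <= b r) -> 0 <= s ->
  forall a' b',
  first_integral T kappa a' b' s (bernoulli_sol T kappa a b s) =
  expR (tail_int T a s - tail_int T a' s) * (1 + discounted T a b s)
   - discounted T a' b' s.
Proof.
move=> b0 s0 a' b'; rewrite /first_integral expRK mulKf ?gt_eqF//.
by rewrite addrAC [in LHS]expRD lnK// posrE ltr_wpDr ?discounted_ge0.
Qed.

(** The first integral of f is constant, and equals 1 at T. *)
Lemma bernoulli_sol_unique a b f s :
    ess_bounded T a -> ess_bounded T b ->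
    (forall r, r \in `[0, T] -> 0 < f r) ->
    (forall r, r \in `[0, T] -> has_rate T r f (fun x => bernoulli kappa a b x (f r))) ->
    f T = 1 -> s \in `[0, T] -> f s = bernoulli_sol T kappa a b s.
Proof.
move=> ba bb f0 fh fT sT.
have bh r : ess_bounded T (fun x => bernoulli kappa a b x (f r)).
  by apply/ess_boundedZ/ess_boundedD; exact: ess_boundedZ.
have wh r : r \in `[0, T] ->
  has_rate T r (fun x => first_integral T kappa a b x (f x)) (cst 0).
  move=> rT; have := has_rate_first_integral rT ba bb (bh r) (f0 r rT) (fh r rT).
  apply: eq_has_rate => // x xT /=.
  rewrite /bernoulli /powR gt_eqF ?f0// mulrBl mul1r !expRD lnK ?posrE ?f0//.
  rewrite [expR (- (_ * _))]expRN; have := expR_gt0 (kappa^-1 * ln (f r)).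
  have := f0 r rT; move: (expR (kappa^-1 * _)) => q fr0 q0.
  by field; rewrite !gt_eqF.
rewrite -[LHS](first_integralK a b s) ?f0//.
have -> : first_integral T kappa a b s (f s) = 1.
  have := has_rate_int wh sT; rewrite {2}/first_integral /discounted fT ln1 mulr0.
  by rewrite !tail_intT !subr0 expR0 /tail_int Rintegral_cst// mul0r addr0.
by rewrite /bernoulli_sol [1 + _]addrC.
Qed.

Lemma bernoulli_sol_rate a b s : s \in `[0, T] ->
    ess_bounded T a -> ess_bounded T b ->
    (forall r, r \in `[0, T] -> 0 <= b r) ->
  has_rate T s (bernoulli_sol T kappa a b)
    (fun r => bernoulli kappa a b r (bernoulli_sol T kappa a b s)).
Proof.
move=> sT ba bb b0.
have V0 : 0 < 1 + discounted T a b s.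
  by rewrite ltr_wpDr// discounted_ge0// itv_ge0.
have bz := ess_bounded_cst (T := T) 0.
have H1 := has_rateD sT bz (ess_boundedZ _ bb) (has_rate_cst 1 s) (has_rate_discounted sT ba bb).
have b1 := ess_boundedD bz (ess_boundedZ (expR (- tail_int T a s)) bb).
have H2 := has_rate_comp sT b1 H1 (is_derive1_ln V0).
have b2 := ess_boundedD ba (ess_boundedZ (1 + discounted T a b s)^-1 b1).
have H3 := has_rateD sT ba (ess_boundedZ _ b1) (has_rate_tail_int s a) H2.
have H4 := has_rate_comp sT (ess_boundedZ _ b2) (has_rateZ kappa sT b2 H3) (is_derive_expR _).
apply: eq_has_rate H4 => //= r rT.
rewrite add0r -/(bernoulli_sol _ _ _ _ _) /bernoulli /powR gt_eqF ?bernoulli_sol_gt0//.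
have -> : expR ((1 - kappa^-1) * ln (bernoulli_sol T kappa a b s)) =
  bernoulli_sol T kappa a b s * (expR (- tail_int T a s) / (1 + discounted T a b s)).
  rewrite mulrBl mul1r expRD lnK ?posrE ?bernoulli_sol_gt0//; congr (_ * _).
  by rewrite /bernoulli_sol expRK mulKf ?gt_eqF// opprD expRD [X in _ * X]expRN lnK.
by ring.
Qed.

Lemma bernoulli_sol_continuous a b :
    ess_bounded T a -> ess_bounded T b ->
    (forall r, r \in `[0, T] -> 0 <= b r) ->
  {within `[0, T], continuous (bernoulli_sol T kappa a b)}.
Proof.
move=> ba bb b0; apply: has_rate_continuous => s sT; eexists; last first.
  exact: bernoulli_sol_rate.
by apply/ess_boundedZ/ess_boundedD; exact: ess_boundedZ.
Qed.

(** Along the solution for a, b the first integral of a', b' is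
    exp(A - A') (1 + V) - V'.  On [t, t1] the difference A - A' is a constant del,
    so V - exp(- del) V' is constant there as well. *)
Lemma first_integral_sol_eq a b a' b' t t1 : 0 <= t -> t <= t1 -> t1 <= T ->
    ess_bounded T a -> ess_bounded T b ->
    ess_bounded T a' -> ess_bounded T b' ->
    (forall r, r \in `[0, T] -> 0 <= b r) ->
    {in `[t, t1[, a =1 a'} -> {in `[t, t1[, b =1 b'} ->
  first_integral T kappa a' b' t (bernoulli_sol T kappa a b t) =
  first_integral T kappa a' b' t1 (bernoulli_sol T kappa a b t1).
Proof.
move=> t0 tt1 t1T ba bb ba' bb' b0 aa' bb''.
have t10 := le_trans t0 tt1.
rewrite !first_integral_sol//.
pose del := tail_int T a t1 - tail_int T a' t1.
have delE s : t <= s -> s <= t1 -> tail_int T a s - tail_int T a' s = del.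
  move=> ts st1; have : tail_int T a s - tail_int T a t1 =
      tail_int T a' s - tail_int T a' t1.
    apply: eq_tail_int_sub => //; first exact: le_trans ts.
    move=> x; rewrite in_itv/= => /andP[sx xt]; apply: aa'.
    by rewrite in_itv/= (le_trans ts).
  by rewrite /del; lra.
have VE : discounted T a b t - discounted T a b t1 =
    expR (- del) * (discounted T a' b' t - discounted T a' b' t1).
  rewrite mulrBr -!tail_intZ//; [|exact: ess_bounded_discounted..].
  apply: eq_tail_int_sub => //; [exact: ess_bounded_discounted| |].
    exact/ess_boundedZ/ess_bounded_discounted.
  move=> x /[dup] xt; rewrite in_itv/= => /andP[tx xt1].
  rewrite bb''// mulrA -expRD; congr (expR _ * _).
  have := delE x tx (ltW xt1); lra.
rewrite !delE//.
have -> : discounted T a b t = discounted T a b t1 +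
    expR (- del) * (discounted T a' b' t - discounted T a' b' t1).
  by rewrite -VE; ring.
rewrite expRN; have := expR_gt0 del; move: (expR del) => q q0.
by field; rewrite gt_eqF.
Qed.

Lemma bernoulli_sol_eq a b a' b' t : 0 <= t ->
    {in `[t, T], a =1 a'} -> {in `[t, T], b =1 b'} ->
  bernoulli_sol T kappa a b t = bernoulli_sol T kappa a' b' t.
Proof.
move=> t0 aa' bb'.
have AE s : t <= s -> tail_int T a s = tail_int T a' s.
  move=> ts; apply: eq_Rintegral => r; rewrite inE/= in_itv/= => /andP[sr rT].
  by apply: aa'; rewrite in_itv/= rT (le_trans ts).
have VE : discounted T a b t = discounted T a' b' t.
  apply: eq_Rintegral => r; rewrite inE => rtT; congr (expR (- _) * _).
    by apply: AE; move: rtT; rewrite /= in_itv/= => /andP[].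
  exact: bb'.
by rewrite /bernoulli_sol VE AE.
Qed.

(** The function of s is the value at t of the solution with coefficients a, b that
    takes the value f s at time s.  Moving s to the right of t changes it at the
    rate of f minus the rate of that solution. *)
Lemma has_rate_spike a b f h t : t \in `[0, T] ->
    ess_bounded T a -> ess_bounded T b -> ess_bounded T h ->
    0 < f t -> has_rate T t f h ->
  has_rate T t (fun s => expR (kappa * (tail_int T a t +
       ln (discounted T a b t + first_integral T kappa a b s (f s)))))
    (fun r => h r - bernoulli kappa a b r (f t)).
Proof.
move=> tT ba bb bh f0 fh.
have wh := has_rate_first_integral tT ba bb bh f0 fh.
set x := first_integral T kappa a b t (f t) in wh.
set V := discounted T a b t.
have Vx : V + x = expR (kappa^-1 * ln (f t) - tail_int T a t).
  by rewrite /V /x /first_integral addrC subrK.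
have Vx0 : 0 < V + x by rewrite Vx expR_gt0.
have bw : ess_bounded T (fun r => expR (kappa^-1 * ln (f t) - tail_int T a t) *
                (kappa^-1 * (f t)^-1 * h r - a r)
              - expR (- tail_int T a t) * b r).
  apply: ess_boundedB; last exact: ess_boundedZ.
  by apply/ess_boundedZ/ess_boundedB => //; exact: ess_boundedZ.
have bz := ess_bounded_cst (T := T) 0.
have H1 := has_rateD tT bz bw (has_rate_cst V t) wh.
have H2 := has_rate_comp tT (ess_boundedD bz bw) H1 (is_derive1_ln Vx0).
have b2 := ess_boundedZ (V + x)^-1 (ess_boundedD bz bw).
have H3 := has_rateD tT bz b2 (has_rate_cst (tail_int T a t) t) H2.
have H4 := has_rate_comp tT (ess_boundedZ kappa (ess_boundedD bz b2))
  (has_rateZ kappa tT (ess_boundedD bz b2) H3) (is_derive_expR _).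
apply: eq_has_rate H4 => //= r rT.
rewrite first_integralK// !add0r.
rewrite Vx /bernoulli /powR gt_eqF// mulrBl mul1r !expRD lnK//.
rewrite [expR (- (_ * _))]expRN; have := expR_gt0 (kappa^-1 * ln (f t)).
have := expR_gt0 (- tail_int T a t).
move: (expR (kappa^-1 * _)) (expR (- tail_int _ _ _)) => q p p0 q0.
by field; rewrite !gt_eqF.
Qed.

End Bernoulli.

(** * Pointwise optimality of the candidate *)

Section PointwiseOptimum.
Context {R : realType}.

(** Bernoulli's inequality for exponents below 1, read off Young's inequality
    between y^a and 1 with exponents 1/a and 1/(1-a). *)
Lemma powR_le_tangent (a y : R) : 0 < a < 1 -> 0 <= y ->
  y `^ a <= 1 + a * (y - 1).
Proof.
move=> /andP[a0 a1] y0.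
have := @conjugate_powR R (y `^ a) 1 a^-1 (1 - a)^-1 (powR_ge0 _ _) ler01.
rewrite !invrK subrKC invr_gt0 a0 invr_gt0 subr_gt0 a1 mulr1 => /(_ isT isT erefl).
by rewrite powR1 -powRrM divff ?gt_eqF// powRr1//; lra.
Qed.

(** The first-order condition x^q cb^(alpha - 1) = S determines cb; by concavity of
    the power, the tangent at cb lies above the graph. *)
Lemma consumption_optimal (alpha gamma S x c q cb : R) : 0 < alpha < 1 ->
    0 < gamma < 1 -> 0 < S -> 0 < x -> 0 <= c ->
    q = (1 - gamma - alpha) / (1 - gamma) ->
    cb = S `^ (alpha - 1)^-1
         * x `^ ((1 - gamma - alpha) / ((1 - alpha) * (1 - gamma))) ->
  alpha^-1 * x `^ q * c `^ alpha - S * c <=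
  alpha^-1 * x `^ q * cb `^ alpha - S * cb.
Proof.
move=> /[dup] al /andP[al0 al1] /andP[g0 g1] S0 x0 c0 qE cbE.
have cb0 : 0 < cb by rewrite cbE mulr_gt0// powR_gt0.
(* The first-order condition, multiplied by cb. *)
have Scb : x `^ q * cb `^ alpha = S * cb.
  have -> : cb `^ alpha = cb * cb `^ (alpha - 1).
    by rewrite mulrC -[X in _ * X]powRr1 ?ltW// -powRD ?subrK// gt_eqF// implybT.
  rewrite {2}cbE powRM ?powR_ge0// -!powRrM mulVf ?powRr1 ?ltW//; last first.
    by rewrite subr_eq0 lt_eqF.
  rewrite (_ : _ * (alpha - 1) = - q); last first.
    rewrite qE; field.
    by rewrite !subr_eq0 !gt_eqF.
  by rewrite powRN; field; rewrite gt_eqF// powR_gt0.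
have -> : c = cb * (c / cb) by rewrite mulrC divfK// gt_eqF.
have y0 : 0 <= c / cb by rewrite divr_ge0// ltW.
move: (c / cb) y0 => y y0; rewrite powRM ?(ltW cb0)//.
rewrite -subr_ge0 [leRHS](_ : _ =
  alpha^-1 * S * cb * (1 + alpha * (y - 1) - y `^ alpha)); last first.
  rewrite [X in _ - X](_ : _ = alpha^-1 * (x `^ q * cb `^ alpha) * y `^ alpha
    - S * (cb * y)); last by ring.
  by rewrite -mulrA Scb; field; rewrite gt_eqF.
by rewrite mulr_ge0 ?subr_ge0 ?powR_le_tangent// !mulr_ge0 ?invr_ge0 ?ltW.
Qed.

Lemma investment_optimal (k m p : R) : 0 < k ->
  m * p - k / 2 * p ^+ 2 <= m * (m / k) - k / 2 * (m / k) ^+ 2.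
Proof.
move=> k0; rewrite -subr_ge0 [leRHS](_ : _ = k / 2 * (p - m / k) ^+ 2).
  by rewrite mulr_ge0 ?sqr_ge0// ltW// divr_gt0.
by field; rewrite gt_eqF.
Qed.

Variables (N : nat) (nu mu sigma gamma alpha : R) (rho : 'I_N -> R).
Implicit Types (pi c : 'I_N -> R -> R) (theta : 'I_N -> R).

(** In the sum the shadow price of every consumption rate is the sum of the theta_i,
    because each rate depletes the wealth of all agents; so the sum separates into
    a function of the total investment and functions of the single rates. *)
Lemma sum_vartheta_field pi c theta r :
  \sum_i vartheta_field nu mu sigma gamma alpha rho pi c i r (theta i) =
  (1 - gamma) * ((\sum_i theta i) * ((mu - nu) * (\sum_i pi i r) -
      gamma * sigma ^+ 2 / 2 * (\sum_i pi i r) ^+ 2)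
    + \sum_i (alpha^-1 * theta i `^ ((1 - gamma - alpha) / (1 - gamma))
          * c i r `^ alpha - (\sum_j theta j) * c i r)
    + \sum_i theta i * (nu - rho i / alpha)).
Proof.
rewrite /vartheta_field; set P := \sum_i pi i r; set C := \sum_i c i r.
transitivity (\sum_i (1 - gamma) * (theta i * ((mu - nu) * P -
      gamma * sigma ^+ 2 / 2 * P ^+ 2)
    + (alpha^-1 * theta i `^ ((1 - gamma - alpha) / (1 - gamma))
          * c i r `^ alpha - theta i * C)
    + theta i * (nu - rho i / alpha))).
  by apply: eq_bigr => i _; ring.
rewrite -mulr_sumr !big_split/= -mulr_suml; congr (_ * (_ + (_ + _) + _)).
by rewrite !sumrN -mulr_suml -mulr_sumr.
Qed.

(** Two times occur because the candidate is frozen at the start t of the spike,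
    whereas the deviation is only measurable and is integrated over r. *)
Lemma vartheta_field_optimal pi c pib cb theta r t :
    (0 < N)%N -> 0 < sigma -> 0 < gamma < 1 -> 0 < alpha < 1 ->
    (forall i, 0 < theta i) -> (forall i, 0 <= c i r) ->
    \sum_i pib i t = (mu - nu) / (gamma * sigma ^+ 2) ->
    (forall i, cb i t = (\sum_j theta j) `^ (alpha - 1)^-1
      * theta i `^ ((1 - gamma - alpha) / ((1 - alpha) * (1 - gamma)))) ->
  \sum_i vartheta_field nu mu sigma gamma alpha rho pi c i r (theta i) <=
  \sum_i vartheta_field nu mu sigma gamma alpha rho pib cb i t (theta i).
Proof.
move=> N0 s0 g al th0 c0 pibE cbE; have /andP[g0 g1] := g.
have S0 : 0 < \sum_i theta i.
  rewrite (bigD1 (Ordinal N0))//= ltr_wpDr// sumr_ge0// => i _; exact: ltW.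
rewrite !sum_vartheta_field ler_wpM2l ?subr_ge0 ?(ltW g1)// lerD2r lerD//.
  rewrite ler_wpM2l ?(ltW S0)// pibE; apply: investment_optimal.
  by rewrite mulr_gt0// exprn_gt0.
by apply: ler_sum => i _; exact: (consumption_optimal al g).
Qed.

End PointwiseOptimum.

(** * The vartheta equation as a Bernoulli equation *)

Section Vartheta.
Context {R : realType} {N : nat} {T nu mu sigma gamma alpha : R}.
Context {rho : 'I_N -> R}.
Hypotheses (T_gt0 : 0 < T) (gamma01 : 0 < gamma < 1) (alpha01 : 0 < alpha < 1).
Implicit Types (pi c : 'I_N -> R -> R) (i : 'I_N).

(** Scaled by alpha, so that the exponent kappa = (1 - gamma) / alpha can be factored
    out of both terms of the equation. *)
Definition growth pi c i (r : R) : R :=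
  alpha * ((mu - nu) * (\sum_j pi j r) - (\sum_j c j r) + nu
     - gamma * sigma ^+ 2 / 2 * (\sum_j pi j r) ^+ 2 - rho i / alpha).

Definition inflow c i (r : R) : R := c i r `^ alpha.

Local Notation kappa := ((1 - gamma) / alpha).

Lemma kappa_gt0 : 0 < kappa.
Proof. by move: gamma01 alpha01 => /andP[? ?] /andP[? ?]; rewrite divr_gt0// subr_gt0. Qed.

Lemma vartheta_fieldE pi c i r v :
  vartheta_field nu mu sigma gamma alpha rho pi c i r v =
  bernoulli kappa (growth pi c i) (inflow c i) r v.
Proof.
move: gamma01 alpha01 => /andP[g0 g1] /andP[al0 al1].
rewrite /bernoulli /inflow; have -> : 1 - kappa^-1 = (1 - gamma - alpha) / (1 - gamma).
  by field; rewrite subr_eq0 !gt_eqF.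
rewrite /vartheta_field /growth.
by field; rewrite gt_eqF.
Qed.

Lemma growth_bounded pi c i : admissible T pi c -> ess_bounded T (growth pi c i).
Proof.
move=> adm.
have bp : ess_bounded T (fun r => \sum_j pi j r).
  by apply: ess_bounded_sum => j; apply: Linfty_plus_ess_bounded; case: (adm j).
have bc : ess_bounded T (fun r => \sum_j c j r).
  by apply: ess_bounded_sum => j; apply: Linfty_plus_ess_bounded; case: (adm j).
apply: ess_boundedZ; apply: ess_boundedB; last exact: ess_bounded_cst.
apply: ess_boundedB; last by apply: ess_boundedZ; exact: ess_boundedM.
apply: ess_boundedD; last exact: ess_bounded_cst.
by apply: ess_boundedB => //; exact: ess_boundedZ.
Qed.

Lemma inflow_bounded pi c i : admissible T pi c -> ess_bounded T (inflow c i).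
Proof.
move=> adm; have [_ ci] := adm i; apply: ess_bounded_powR.
- by case/andP: alpha01 => /ltW.
- by case: ci.
- exact: Linfty_plus_ess_bounded.
Qed.

Lemma inflow_ge0 c i r : 0 <= inflow c i r.
Proof. exact: powR_ge0. Qed.

(** The closed form is a positive solution, so the choice in the definition of
    vartheta returns a solution, which by uniqueness is the closed form. *)
Lemma varthetaE pi c i s : admissible T pi c -> s \in `[0, T] ->
  vartheta T nu mu sigma gamma alpha rho pi c i s =
  bernoulli_sol T kappa (growth pi c i) (inflow c i) s.
Proof.
move=> adm sT; have ba := growth_bounded i adm; have bb := inflow_bounded i adm.
have k0 := kappa_gt0.
have b0 r : r \in `[0, T] -> 0 <= inflow c i r by move=> _; exact: inflow_ge0.
set sol := bernoulli_sol _ _ _ _.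
have csol : {within `[0, T], continuous sol} by exact: bernoulli_sol_continuous.
have sol0 r : r \in `[0, T] -> 0 < sol r by move=> _; exact: bernoulli_sol_gt0.
have rsol r : r \in `[0, T] ->
    has_rate T r sol (fun x => bernoulli kappa (growth pi c i) (inflow c i) x (sol x)).
  move=> rT; apply: (iffRL (bernoulli_rate_frozen rT ba bb csol sol0)).
  exact: bernoulli_sol_rate.
have solP : vartheta_solution T nu mu sigma gamma alpha rho pi c i sol.
  split => // r rT; rewrite (has_rate_int rsol rT) {1}/sol bernoulli_solT.
  by congr (1 + _); apply: eq_Rintegral => x _; rewrite vartheta_fieldE.
have [cv v0 vE] : vartheta_solution T nu mu sigma gamma alpha rho pi c i
    (vartheta T nu mu sigma gamma alpha rho pi c i) by exact: xgetI solP.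
set v := vartheta _ _ _ _ _ _ _ _ _ _ in cv v0 vE *.
apply: (bernoulli_sol_unique k0 ba bb v0 _ _ sT); last first.
  rewrite vE; last by rewrite in_itv/= lexx ltW.
  by rewrite set_itv1 Rintegral_set1 addr0.
move=> r rT; apply: (iffLR (bernoulli_rate_frozen rT ba bb cv v0)).
have vE' x : x \in `[0, T] -> v x = 1 + tail_int T
    (fun x => bernoulli kappa (growth pi c i) (inflow c i) x (v x)) x.
  by move=> /vE ->; congr (1 + _); apply: eq_Rintegral => y _; rewrite vartheta_fieldE.
apply: (@eq_flat_at _ _ _ (cst 1)) => // [x xT|]; first by rewrite vE' ?addrK.
by move=> e e0; apply: filterE => x _; rewrite subrr normr0 mulr_ge0// ltW.
Qed.

End Vartheta.

(** * Spike perturbations of the equilibrium *)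

Section Perturb.
Context {R : realType} {T : R}.

Lemma ess_bounded_Linfty_plus (f : R -> R) :
  (forall r, r \in `[0, T] -> 0 <= f r) -> ess_bounded T f -> Linfty_plus T f.
Proof.
move=> f0 [mf [M M0 fM]]; split => //; exists M.
by apply: aeS fM => r fr /fr; exact: le_trans (ler_norm _).
Qed.

Lemma Linfty_plus_perturb (t e : R) n (p pbar : 'I_n -> R -> R) i :
  Linfty_plus T (p i) -> Linfty_plus T (pbar i) ->
  Linfty_plus T (perturb t e p pbar i).
Proof.
move=> [mp p0 [M pM]] [mq q0 [M' qM]]; split.
- rewrite /perturb; apply: measurable_fun_if => //.
  + apply: measurable_and.
    by apply: measurable_fun_ler => //; exact: measurable_cst.
    by apply: measurable_fun_ltr => //; exact: measurable_cst.
  + by apply: measurable_funS mp.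
  + by apply: measurable_funS mq.
- by move=> r rT; rewrite /perturb; case: ifP => _; [exact: p0|exact: q0].
- exists (Num.max M M'); apply: aeS2 pM qM => r hp hq rT.
  by rewrite /perturb le_max; case: ifP => _; rewrite ?hp ?hq ?orbT.
Qed.

Lemma limf_esup_le0 (f : R -> R) (F : set (set R)) :
  (forall eta, 0 < eta -> F [set e | f e <= eta]) ->
  (limf_esup (fun e => (f e)%:E) F <= 0)%E.
Proof.
move=> fF; apply/lee_addgt0Pr => eta eta0; rewrite add0e.
apply: (@le_trans _ _ (ereal_sup ((fun e => (f e)%:E) @` [set e | f e <= eta]))).
  by apply: ereal_inf_lbound => /=; exists [set e | f e <= eta] => //; exact: fF.
by apply: ge_ereal_sup => _ /= [e fe <-]; rewrite lee_fin.
Qed.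

End Perturb.

Section Equilibrium.
Context {R : realType} {N : nat} {T gamma alpha sigma nu mu : R}.
Context {rho : 'I_N -> R} {theta dtheta : 'I_N -> R -> R}.
Context {pibar cbar : 'I_N -> R -> R}.
Hypotheses (N_gt0 : (0 < N)%N) (T_gt0 : 0 < T).
Hypotheses (gamma01 : 0 < gamma < 1) (alpha01 : 0 < alpha < 1).
Hypothesis sigma_gt0 : 0 < sigma.
Hypothesis theta_derive : forall i t, t \in `[0, T] ->
  is_derive_within `[0, T] (theta i) t (dtheta i t).
Hypothesis theta_ode : forall i t, t \in `[0, T] ->
  dtheta i t
  + (1 - gamma) * theta i t *
    (nu + (mu - nu) ^+ 2 / (2 * gamma * sigma ^+ 2)
     - (\sum_j theta j t) `^ (alpha - 1)^-1
       * \sum_k theta k t `^ ((1 - gamma - alpha)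
                              / ((1 - alpha) * (1 - gamma))))
  - (1 - gamma) * rho i * alpha^-1 * theta i t
  + alpha^-1 * (1 - gamma)
    * theta i t `^ ((1 - gamma - alpha) / ((1 - alpha) * (1 - gamma)))
    * (\sum_j theta j t) `^ (alpha / (alpha - 1)) = 0.
Hypothesis theta_T : forall i, theta i T = 1.
Hypothesis theta_gt0 : forall i t, t \in `[0, T] -> 0 < theta i t.
Hypothesis hpibar : forall i, Linfty_plus T (pibar i).
Hypothesis pibar_sum : forall t, t \in `[0, T] ->
  \sum_i pibar i t = (mu - nu) / (gamma * sigma ^+ 2).
Hypothesis cbar_def : forall i t, t \in `[0, T] ->
  cbar i t = (\sum_j theta j t) `^ (alpha - 1)^-1
             * theta i t `^ ((1 - gamma - alpha) / ((1 - alpha) * (1 - gamma))).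
Implicit Types (pi c : 'I_N -> R -> R) (i : 'I_N).

Local Notation kappa := ((1 - gamma) / alpha).
Local Notation growth := (growth (nu := nu) (mu := mu) (sigma := sigma)
  (gamma := gamma) (alpha := alpha) (rho := rho)).
Local Notation inflow := (inflow (alpha := alpha)).
Local Notation vartheta := (vartheta T nu mu sigma gamma alpha rho).
Local Notation field := (vartheta_field nu mu sigma gamma alpha rho).

Lemma theta_continuous i : {within `[0, T], continuous (theta i)}.
Proof.
apply: has_rate_continuous => s sT; exists (cst (- dtheta i s)).
  exact: ess_bounded_cst.
exact: (has_rate_derive sT (@theta_derive i _ sT)).
Qed.

Lemma sum_theta_gt0 t : t \in `[0, T] -> 0 < \sum_i theta i t.
Proof.
move=> tT; rewrite (bigD1 (Ordinal N_gt0))//= ltr_wpDr ?theta_gt0// sumr_ge0// => i _.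
by rewrite ltW ?theta_gt0.
Qed.

Lemma cbar_gt0 i t : t \in `[0, T] -> 0 < cbar i t.
Proof. by move=> tT; rewrite cbar_def// mulr_gt0// powR_gt0 ?sum_theta_gt0 ?theta_gt0. Qed.

Lemma cbar_continuous i : {within `[0, T], continuous (cbar i)}.
Proof.
apply: (@eq_itv_continuous _ _ (fun t => (\sum_j theta j t) `^ (alpha - 1)^-1
             * theta i t `^ ((1 - gamma - alpha) / ((1 - alpha) * (1 - gamma))))).
  by move=> t tT; rewrite cbar_def.
apply: within_continuousM; apply: within_continuous_powR.
- apply: within_continuous_sum => j; exact: theta_continuous.
- exact: sum_theta_gt0.
- exact: theta_continuous.
- exact: theta_gt0.
Qed.

Lemma admissible_bar : admissible T pibar cbar.
Proof.
move=> i; split => //; apply: ess_bounded_Linfty_plus.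
  by move=> r rT; rewrite ltW ?cbar_gt0.
exact/ess_bounded_continuous/cbar_continuous.
Qed.

Lemma inflow_bar_continuous i : {within `[0, T], continuous (inflow cbar i)}.
Proof.
apply: within_continuous_powR; first exact: cbar_continuous.
by move=> r rT; rewrite cbar_gt0.
Qed.

Lemma growth_bar_continuous i : {within `[0, T], continuous (growth pibar cbar i)}.
Proof.
pose P := (mu - nu) / (gamma * sigma ^+ 2).
pose K := alpha * ((mu - nu) * P + nu - gamma * sigma ^+ 2 / 2 * P ^+ 2 - rho i / alpha).
apply: (@eq_itv_continuous _ _ (fun t => K - alpha * \sum_j cbar j t)).
  move=> t tT; rewrite /growth pibar_sum//= -/P /K.
  by ring.
apply: (itv_continuous_comp (phi := fun x => K - alpha * x)).
  by apply: within_continuous_sum => j; exact: cbar_continuous.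
move=> r rT; apply: cvgB; first exact: cvg_cst.
exact: mulrl_continuous.
Qed.

(** With q = (1 - gamma - alpha) / (1 - gamma) and p = q / (1 - alpha), the exponent
    of theta_i in the candidate consumption, one has q + p alpha = p; so
    theta_i^q c_i^alpha yields the last term of the system.  The total investment
    turns the quadratic into (mu - nu)^2 / (2 gamma sigma^2). *)
Lemma dthetaE i t : t \in `[0, T] -> - dtheta i t = field pibar cbar i t (theta i t).
Proof.
move=> tT; have th0 := theta_gt0 i tT; have S0 := sum_theta_gt0 tT.
have /andP[g0 g1] := gamma01; have /andP[al0 al1] := alpha01.
have al1' : alpha - 1 != 0 by rewrite subr_eq0 lt_eqF.
have := theta_ode i tT; rewrite /field pibar_sum//.
have -> : \sum_j cbar j t = (\sum_j theta j t) `^ (alpha - 1)^-1 *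
    \sum_k theta k t `^ ((1 - gamma - alpha) / ((1 - alpha) * (1 - gamma))).
  by rewrite mulr_sumr; apply: eq_bigr => j _; rewrite cbar_def.
rewrite cbar_def// powRM ?powR_ge0// -!powRrM.
set p := (1 - gamma - alpha) / ((1 - alpha) * (1 - gamma)).
have -> : theta i t `^ p = theta i t `^ ((1 - gamma - alpha) / (1 - gamma)) *
    theta i t `^ (p * alpha).
  rewrite -powRD; last by rewrite (gt_eqF th0) implybT.
  congr powR; rewrite /p; field.
  by rewrite !subr_eq0 !gt_eqF.
rewrite [(alpha - 1)^-1 * alpha]mulrC => ode.
apply/eqP; rewrite -subr_eq0 -oppr_eq0; apply/eqP; rewrite -[RHS]ode.
field; rewrite !gt_eqF//.
Qed.

(** The frozen right-hand side is continuous in time, hence may be replaced by its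
    value at the base point, which is - dtheta. *)
Lemma theta_vartheta i s : s \in `[0, T] -> theta i s =
  bernoulli_sol T kappa (growth pibar cbar i) (inflow cbar i) s.
Proof.
move=> sT; have k0 := kappa_gt0 gamma01 alpha01.
have ba : ess_bounded T (growth pibar cbar i).
  exact: growth_bounded admissible_bar.
have bb := inflow_bounded alpha01 i admissible_bar.
apply: (bernoulli_sol_unique k0 ba bb (theta_gt0 i) _ (theta_T i) sT).
move=> r rT; pose k x := bernoulli kappa (growth pibar cbar i) (inflow cbar i) x (theta i r).
have ck : {within `[0, T], continuous k}.
  rewrite /k /bernoulli => x; have ca := @growth_bar_continuous i x.
  have cb := @inflow_bar_continuous i x.
  by apply: cvgM; [exact: cvg_cst|apply: cvgD; apply: cvgM => //; exact: cvg_cst].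
have b1 := ess_bounded_cst (T := T) 1; have b0 := ess_bounded_cst (T := T) 0.
have := has_rate_derive rT (@theta_derive i _ rT).
have kr : k r = - dtheta i r by rewrite dthetaE// vartheta_fieldE.
move=> H; have := iffRL (has_rate_freeze (theta i) rT ck b1 b0).
move=> /(_ _)/wrap[|].
  by apply: eq_has_rate H => // x _ /=; rewrite mulr1 addr0 kr.
by apply: eq_has_rate => // x _ /=; rewrite mulr1 addr0.
Qed.

Lemma admissible_perturb pi c t e : admissible T pi c ->
  admissible T (perturb t e pi pibar) (perturb t e c cbar).
Proof.
move=> adm i; have [? ?] := adm i; have [? ?] := admissible_bar i.
by split; exact: Linfty_plus_perturb.
Qed.

(** The utility coefficient at t of agent i when (pi, c) is used on [t, s[ and the
    candidate afterwards. *)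
Definition spiked_value pi c i t s : R :=
  expR (kappa * (tail_int T (growth pi c i) t +
    ln (discounted T (growth pi c i) (inflow c i) t +
      first_integral T kappa (growth pi c i) (inflow c i) s (theta i s)))).

(** After t + e the perturbed coefficient is theta_i, and on the spike the first
    integral of (pi, c) transports the value theta_i (t + e) back to t. *)
Lemma vartheta_perturb pi c i t e : admissible T pi c ->
    0 <= t -> 0 < e -> t + e <= T ->
  vartheta (perturb t e pi pibar) (perturb t e c cbar) i t =
  spiked_value pi c i t (t + e).
Proof.
move=> adm t0 e0 teT; have k0 := kappa_gt0 gamma01 alpha01.
have adme := admissible_perturb t e adm.
have te0 : 0 <= t + e by rewrite addr_ge0// ltW.
have tT : t \in `[0, T] by rewrite in_itv/= t0 (le_trans _ teT)// lerDl ltW.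
have teT' : t + e \in `[0, T] by rewrite in_itv/= te0.
rewrite varthetaE// /spiked_value theta_vartheta//.
set ae := growth _ _ i; set be := inflow _ i.
have -> : bernoulli_sol T kappa (growth pibar cbar i) (inflow cbar i) (t + e) =
    bernoulli_sol T kappa ae be (t + e).
  have pE (p pb : 'I_N -> R -> R) j r : r \in `[t + e, T] -> pb j r = perturb t e p pb j r.
    by rewrite in_itv/= => /andP[ter _]; rewrite /perturb [r < _]ltNge ter andbF.
  apply: bernoulli_sol_eq => // r rT; last by rewrite /be /inflow -pE.
  have sE (p pb : 'I_N -> R -> R) : \sum_j perturb t e p pb j r = \sum_j pb j r.
    by apply: eq_bigr => j _; rewrite -pE.
  by rewrite /ae /growth !sE.
have pE (p pb : 'I_N -> R -> R) j r : r \in `[t, t + e[ -> perturb t e p pb j r = p j r.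
  by rewrite in_itv/= /perturb => ->.
rewrite -(@first_integral_sol_eq _ _ _ k0 ae be _ _ t)//.
- by rewrite first_integralK// bernoulli_sol_gt0.
- by rewrite lerDl ltW.
- exact: growth_bounded.
- exact: inflow_bounded adme.
- exact: growth_bounded.
- exact: inflow_bounded adm.
- by move=> r _; exact: inflow_ge0.
- move=> r rT.
  have sE (p pb : 'I_N -> R -> R) : \sum_j perturb t e p pb j r = \sum_j p j r.
    by apply: eq_bigr => j _; rewrite pE.
  by rewrite /ae /growth !sE.
- by move=> r rT; rewrite /be /inflow pE.
Qed.

Lemma spiked_value0 pi c i t : t \in `[0, T] -> spiked_value pi c i t t = theta i t.
Proof.
by move=> tT; rewrite /spiked_value first_integralK ?theta_gt0//; exact: kappa_gt0.
Qed.

Lemma spiked_value_rate pi c i t : admissible T pi c -> t \in `[0, T] ->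
  has_rate T t (spiked_value pi c i t)
    (fun r => field pibar cbar i t (theta i t) - field pi c i r (theta i t)).
Proof.
move=> adm tT; have k0 := kappa_gt0 gamma01 alpha01.
have bc := ess_bounded_cst (T := T) (- dtheta i t).
have ba : ess_bounded T (growth pi c i) by exact: growth_bounded.
have := has_rate_spike k0 tT ba (inflow_bounded alpha01 i adm)
  bc (theta_gt0 i tT) (has_rate_derive tT (@theta_derive i _ tT)).
move=> H; apply: (eq_has_rate tT _ _ H) => // r rT /=.
by rewrite [field pi c i r _]vartheta_fieldE// dthetaE.
Qed.

Local Notation J := (coalition_objective T nu mu sigma gamma alpha rho).

(** The increment of the objective is a nonnegative multiple of that of the summed
    spiked values, whose rate in reversed time is the nonnegative gap of
    [vartheta_field_optimal]. *)
Theorem coalition_equilibrium pi c t x : 0 <= t < T -> admissible T pi c ->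
  (limf_esup (fun e : R =>
     ((J t x (perturb t e pi pibar) (perturb t e c cbar) - J t x pibar cbar) / e)%:E)
     0^'+ <= 0)%E.
Proof.
move=> /[dup] t0T /andP[t0 tT] adm; apply: limf_esup_le0 => eta eta0.
have tT' : t \in `[0, T] by rewrite in_itv/= t0 ltW.
have /andP[g0 g1] := gamma01.
pose K := N%:R^-1 * (1 - gamma)^-1 * x `^ (1 - gamma).
have K0 : 0 <= K.
  by rewrite !mulr_ge0 ?invr_ge0 ?powR_ge0 ?subr_ge0 ?(ltW g1)// ler0n.
pose h r := \sum_i (field pibar cbar i t (theta i t) - field pi c i r (theta i t)).
have bh i : ess_bounded T
    (fun r => field pibar cbar i t (theta i t) - field pi c i r (theta i t)).
  apply: ess_boundedB; first exact: ess_bounded_cst.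
  have ba : ess_bounded T (growth pi c i) by exact: growth_bounded.
  have bb := inflow_bounded alpha01 i adm.
  apply: (@ess_bounded_eq _ _
    (fun r => bernoulli kappa (growth pi c i) (inflow c i) r (theta i t))).
    by move=> r _; rewrite vartheta_fieldE.
  by apply: ess_boundedZ; apply: ess_boundedD; exact: ess_boundedZ.
have rh : has_rate T t (fun s => \sum_i spiked_value pi c i t s) h.
  by apply: has_rate_sum => // i; exact: spiked_value_rate.
have h0 r : r \in `[0, T] -> 0 <= h r.
  move=> rT; rewrite /h sumrB subr_ge0.
  apply: vartheta_field_optimal => //.
  - by move=> i; exact: theta_gt0.
  - by move=> i; have [_ [_ ->]] := adm i.
  - exact: pibar_sum.
  - by move=> i; rewrite cbar_def.
(* K may vanish, so eta is divided by K + 1. *)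
have e1 : 0 < eta / (K + 1) by rewrite divr_gt0// ltr_wpDl.
have := has_rate_ge0 t0T (ess_bounded_sum bh) h0 rh e1.
move=> H; near=> e => /=.
have e0 : 0 < e by near: e; exact: nbhs_right_gt.
have eT : t + e <= T.
  by rewrite addrC -lerBrDr; near: e; apply: nbhs_right_le; rewrite subr_gt0.
rewrite ler_pdivrMr//.
have -> : J t x (perturb t e pi pibar) (perturb t e c cbar) - J t x pibar cbar =
    K * (\sum_i spiked_value pi c i t (t + e) - \sum_i spiked_value pi c i t t).
  rewrite /coalition_objective -mulrBr -!sumrB /K -!mulrA; congr (_ * _).
  rewrite !mulr_sumr; apply: eq_bigr => i _.
  rewrite /utility vartheta_perturb// spiked_value0// (theta_vartheta i tT').
  rewrite -(varthetaE T_gt0 gamma01 alpha01 _ admissible_bar)//.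
  by ring.
apply: (@le_trans _ _ (K * (eta / (K + 1) * e))).
  by rewrite ler_wpM2l//; near: e; exact: H.
by rewrite !mulrA ler_wpM2r ?(ltW e0)// ler_pdivrMr ?ltr_wpDl// mulrC ler_wpM2l ?(ltW eta0)// lerDl.
Unshelve. all: by end_near. Qed.

End Equilibrium.

Unset Implicit Arguments.
Set Strict Implicit.
Set Printing Implicit Defensive.

Theorem theorem4p4 (R : realType) (d : measure_display)
    (Omega : measurableType d) (P : probability Omega R)
    (W : R -> Omega -> R) (hW : brownian_motion P W)
    (N : nat) (hN : (1 <= N)%N) (T gamma alpha sigma nu mu : R)
    (hT : 0 < T) (hgamma : 0 < gamma < 1) (halpha : 0 < alpha < 1)
    (hsigma : 0 < sigma) (hmu : nu < mu) (rho : 'I_N -> R)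
    (theta dtheta : 'I_N -> R -> R)
    (theta_derive : forall i t, t \in `[0, T] ->
       is_derive_within `[0, T] (theta i) t (dtheta i t))
    (theta_ode : forall i t, t \in `[0, T] ->
       dtheta i t
       + (1 - gamma) * theta i t *
         (nu + (mu - nu) ^+ 2 / (2 * gamma * sigma ^+ 2)
          - (\sum_j theta j t) `^ (alpha - 1)^-1
            * \sum_k theta k t `^ ((1 - gamma - alpha)
                                   / ((1 - alpha) * (1 - gamma))))
       - (1 - gamma) * rho i * alpha^-1 * theta i t
       + alpha^-1 * (1 - gamma)
         * theta i t `^ ((1 - gamma - alpha) / ((1 - alpha) * (1 - gamma)))
         * (\sum_j theta j t) `^ (alpha / (alpha - 1)) = 0)
    (theta_T : forall i, theta i T = 1)
    (theta_gt0 : forall i t, t \in `[0, T] -> 0 < theta i t)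
    (pibar cbar : 'I_N -> R -> R)
    (hpibar : forall i, Linfty_plus T (pibar i))
    (pibar_sum : forall t, t \in `[0, T] ->
       \sum_i pibar i t = (mu - nu) / (gamma * sigma ^+ 2))
    (cbar_def : forall i t, t \in `[0, T] ->
       cbar i t = (\sum_j theta j t) `^ (alpha - 1)^-1
                  * theta i t `^ ((1 - gamma - alpha)
                                  / ((1 - alpha) * (1 - gamma)))) :
  EPICS P W T nu mu sigma gamma alpha rho pibar cbar.
Proof.
split; first exact: (admissible_bar hN theta_derive theta_gt0 hpibar cbar_def).
move=> x0 X _ _ t pi c t0T adm J; apply: aeW => w.
exact: (coalition_equilibrium hN hT hgamma halpha hsigma theta_derive theta_ode
  theta_T theta_gt0 hpibar pibar_sum cbar_def).
Qed.
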